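(* Let $H$ be a graph. The class of $H$-free graphs is bounded-apex-split if and only if $H$ is an induced subgraph of $K_2$ or of $2K_1$.
   Context: All graphs are finite and simple. $K_2$ is the complete graph on two vertices and $2K_1$ the edgeless graph on two vertices. ''Induced subgraph of $X$'' means isomorphic to $X[S]$ for some $S\subseteq V(X)$. A graph is $H$-free if none of its induced subgraphs is isomorphic to $H$. A split graph is a graph whose vertex set can be written as $K\cup S$ where $K$ is a clique and $S$ is a stable set (either may be empty). A class of graphs is bounded-apex-split if there is a constant $c\in\mathbb{N}$ such that every graph $G$ in the class has a set $X\subseteq V(G)$ with $|X|\le c$ such that $G-X$ is a split graph. *)

(* Defs.v *)
From mathcomp Require Import all_boot.

Set Implicit Arguments.
Unset Strict Implicit.
Unset Printing Implicit Defensive.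

Record sgraph := SGraph {
  vertex :> finType;
  edge : rel vertex;
  edge_sym : symmetric edge;
  edge_irrefl : irreflexive edge }.

Definition graph_iso (G H : sgraph) : Prop :=
  exists2 f : G -> H, bijective f & forall x y : G, edge (f x) (f y) = edge x y.

Section Induced.
Variables (G : sgraph) (S : {set G}).

Definition induced_edge : rel {x : G | x \in S} :=
  fun x y => edge (val x) (val y).

Lemma induced_edge_sym : symmetric induced_edge.
Proof. by move=> x y; apply: edge_sym. Qed.

Lemma induced_edge_irrefl : irreflexive induced_edge.
Proof. by move=> x; apply: edge_irrefl. Qed.

Definition induced : sgraph := SGraph induced_edge_sym induced_edge_irrefl.
End Induced.

Definition induced_subgraph (H G : sgraph) : Prop :=
  exists S : {set G}, graph_iso H (induced S).

Definition free (H G : sgraph) : Prop := ~ induced_subgraph H G.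

Definition delete_vertices (G : sgraph) (X : {set G}) : sgraph :=
  induced (~: X).

Definition clique (G : sgraph) (K : {set G}) : Prop :=
  {in K &, forall x y, x != y -> edge x y}.

Definition stable (G : sgraph) (S : {set G}) : Prop :=
  {in S &, forall x y, ~~ edge x y}.

Definition split_graph (G : sgraph) : Prop :=
  exists K S : {set G}, [/\ clique K, stable S & K :|: S = [set: G]].

Definition bounded_apex_split (C : sgraph -> Prop) : Prop :=
  exists c : nat, forall G : sgraph, C G ->
    exists X : {set G}, #|X| <= c /\ split_graph (delete_vertices X).

Section SmallGraphs.
Variable n : nat.

Definition complete_edge : rel 'I_n := fun x y => x != y.

Lemma complete_edge_sym : symmetric complete_edge.
Proof. by move=> x y; rewrite /complete_edge eq_sym. Qed.

Lemma complete_edge_irrefl : irreflexive complete_edge.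
Proof. by move=> x; rewrite /complete_edge eqxx. Qed.

Definition complete_graph : sgraph :=
  SGraph complete_edge_sym complete_edge_irrefl.

Definition edgeless_edge : rel 'I_n := fun _ _ => false.

Lemma edgeless_edge_sym : symmetric edgeless_edge.
Proof. by []. Qed.

Lemma edgeless_edge_irrefl : irreflexive edgeless_edge.
Proof. by []. Qed.

Definition edgeless_graph : sgraph :=
  SGraph edgeless_edge_sym edgeless_edge_irrefl.
End SmallGraphs.

(* Main.v *)
Require Import Defs.
From mathcomp Require Import all_boot.

Set Implicit Arguments.
Unset Strict Implicit.
Unset Printing Implicit Defensive.

(** If [H] embeds in [K_2] (resp. [2K_1]), then an [H]-free graph has no edge
    (resp. no non-edge), so it is itself stable (resp. a clique) and nothing
    has to be deleted.

    Conversely, neither the complete bipartite graphs [K_{n,n}] nor their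
    complements [2K_n] are bounded-apex-split: after deleting [n - 2] vertices,
    both sides still have two vertices, which induce [C_4] or [2K_2]
    ([two_sided_not_apex_split]).  Hence [H] embeds in some [K_{n,n}] and in
    some [2K_n].  The first embedding gives a 2-colouring of [V(H)] in which
    distinct vertices are adjacent iff their colours differ, the second one in
    which they are adjacent iff their colours agree.  So for every pair of
    distinct vertices exactly one of the two colourings separates it.  But a
    2-colouring separates an even number of the three pairs in a triple, and
    three is odd: [H] has at most two vertices ([two_sided_embeddings_small]),
    and is then an induced subgraph of [K_2] or of [2K_1]. *)

(** Working with embeddings instead of vertex subsets makes composition and
    restriction of induced subgraphs immediate. *)
Lemma induced_subgraphP (H G : sgraph) :
  induced_subgraph H G <->
  exists2 f : H -> G, injective f & forall x y, edge (f x) (f y) = edge x y.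
Proof.
split=> [[S [f [g fK _] fE]]|[f f_inj fE]].
  exists (fun x => val (f x)) => [x y /val_inj|x y]; last exact: fE.
  exact: (can_inj fK).
exists [set f x | x : H].
have fS x : f x \in [set f x | x : H] by apply: imset_f.
pose h x : induced [set f x | x : H] := exist _ (f x) (fS x).
exists h => [|x y]; last exact: fE.
have h_inj : injective h by move=> x y /(congr1 val) /f_inj.
apply: inj_card_bij h_inj _.
by rewrite card_sig /= (card_imset _ f_inj).
Qed.

Lemma induced_subgraph_trans (F G H : sgraph) :
  induced_subgraph F G -> induced_subgraph G H -> induced_subgraph F H.
Proof.
move=> /induced_subgraphP [f f_inj fE] /induced_subgraphP [g g_inj gE].
apply/induced_subgraphP; exists (g \o f) => [|x y /=]; first exact: inj_comp.
by rewrite gE fE.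
Qed.

Lemma ord2_select_inj (T : eqType) (x y : T) :
  x != y -> injective (fun i : 'I_2 => if i == ord0 then x else y).
Proof.
move=> neq; case=> [[|[|//]] ?] [[|[|//]] ?] //= e; try exact: val_inj.
  by rewrite e eqxx in neq.
by rewrite e eqxx in neq.
Qed.

Lemma induced_complete2 (G : sgraph) (x y : G) :
  edge x y -> induced_subgraph (complete_graph 2) G.
Proof.
move=> xy; apply/induced_subgraphP.
have yx : edge y x by rewrite edge_sym.
have neq : x != y by apply: contraTneq xy => ->; rewrite edge_irrefl.
exists (fun i : 'I_2 => if i == ord0 then x else y).
  exact: ord2_select_inj.
by case=> [[|[|//]] ?] [[|[|//]] ?]; rewrite /= ?edge_irrefl.
Qed.

Lemma induced_edgeless2 (G : sgraph) (x y : G) :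
  x != y -> ~~ edge x y -> induced_subgraph (edgeless_graph 2) G.
Proof.
move=> neq /negbTE xy; apply/induced_subgraphP.
have yx : edge y x = false by rewrite edge_sym.
exists (fun i : 'I_2 => if i == ord0 then x else y).
  exact: ord2_select_inj.
by case=> [[|[|//]] ?] [[|[|//]] ?]; rewrite /= ?edge_irrefl.
Qed.

Lemma card_le2_induced (H : sgraph) : #|H| <= 2 ->
  induced_subgraph H (complete_graph 2) \/
  induced_subgraph H (edgeless_graph 2).
Proof.
move=> H2; pose f (x : H) : 'I_2 := widen_ord H2 (enum_rank x).
have f_inj : injective f.
  by move=> x y /(congr1 val) /= /val_inj /enum_rank_inj.
case: (boolP [exists x : H, exists y : H, edge x y]) => [|noedge].
  case/existsP=> a /existsP [b ab]; left; apply/induced_subgraphP; exists f => //.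
  move=> x y; rewrite -[LHS]/(f x != f y) (inj_eq f_inj).
  have neq : a != b by apply: contraTneq ab => ->; rewrite edge_irrefl.
  have cover z : (z == a) || (z == b).
    move: (H2); apply: contraTT; rewrite negb_or -ltnNge => /andP [za zb].
    by apply/card_gt2P; exists z, a, b; split; split; rewrite // eq_sym.
  have ba : edge b a by rewrite edge_sym.
  by case/orP: (cover x) => /eqP ->; case/orP: (cover y) => /eqP ->;
    rewrite ?edge_irrefl ?eqxx ?ab ?ba // eq_sym.
right; apply/induced_subgraphP; exists f => // x y.
apply/esym/negbTE; apply: contra noedge => xy.
by apply/existsP; exists x; apply/existsP; exists y.
Qed.

Section TwoSided.
Variables (p : bool) (n : nat).

(** [K_{n,n}] when [p] is false and [2K_n] when [p] is true; the parameter
    lets the two complementary families share one proof. *)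
Definition two_sided_edge : rel (bool * 'I_n) :=
  fun x y => (x != y) && ((x.1 == y.1) == p).

Lemma two_sided_edge_sym : symmetric two_sided_edge.
Proof. by move=> x y; rewrite /two_sided_edge eq_sym (eq_sym x.1). Qed.

Lemma two_sided_edge_irrefl : irreflexive two_sided_edge.
Proof. by move=> x; rewrite /two_sided_edge eqxx. Qed.

Definition two_sided : sgraph :=
  SGraph two_sided_edge_sym two_sided_edge_irrefl.
End TwoSided.

Lemma two_survivors_per_side (p : bool) (c : nat)
    (X : {set two_sided p c.+2}) (b : bool) : #|X| <= c ->
  exists u v : delete_vertices X,
    [/\ u != v, (val u).1 = b & (val v).1 = b].
Proof.
move=> Xc; pose D := [set i : 'I_c.+2 | ((b, i) : two_sided p c.+2) \in X].
have Dc : #|D| <= c.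
  have pair_inj : injective (fun i => (b, i) : two_sided p c.+2).
    by move=> i j [].
  rewrite -(card_imset _ pair_inj); apply: leq_trans Xc.
  by apply/subset_leq_card/subsetP => _ /imsetP [i iD ->]; rewrite inE in iD.
have : 1 < #|~: D|.
  by rewrite -(ltn_add2l #|D|) cardsC card_ord addn1 !ltnS.
case/card_gt1P=> i [j [iD jD ij]].
have out k : k \in ~: D -> ((b, k) : two_sided p c.+2) \in ~: X.
  by rewrite !inE.
pose w k (kD : k \in ~: D) : delete_vertices X :=
  exist (fun x : two_sided p c.+2 => x \in ~: X) (b, k) (out k kD).
exists (w i iD), (w j jD); split=> //.
by apply: contra ij => /eqP /(congr1 val) [->].
Qed.

(** Of two surviving vertices on one side, the part of the split partition
    that is of the type opposite to the sides (the clique in [K_{n,n}], the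
    stable set in [2K_n]) holds at most one.  So the other part meets both
    sides, which is impossible. *)
Lemma two_sided_not_apex_split (p : bool) (c : nat)
    (X : {set two_sided p c.+2}) :
  #|X| <= c -> ~ split_graph (delete_vertices X).
Proof.
move=> Xc [K [S [clK stS KS]]].
have cover w : (w \in K) || (w \in S) by rewrite -in_setU KS inE.
have edgeE (u v : delete_vertices X) :
    edge u v = (u != v) && (((val u).1 == (val v).1) == p).
  by rewrite -val_eqE.
have meets b : exists2 u, u \in (if p then K else S) & (val u).1 = b.
  have [u [v [uv ub vb]]] := two_survivors_per_side b Xc.
  have euv : edge u v = p by rewrite edgeE uv ub vb eqxx /=; case: (p : bool).
  case/orP: (orbN p) => pE.
    rewrite ifT //; case/orP: (cover u) => uP; first by exists u.
    case/orP: (cover v) => vP; first by exists v.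
    by have := stS _ _ uP vP; rewrite euv => /negP[].
  rewrite ifN //; case/orP: (cover u) => uP; last by exists u.
  case/orP: (cover v) => vP; last by exists v.
  by have := clK _ _ uP vP uv; rewrite euv => /(negP pE).
have [u uP ub] := meets true; have [v vP vb] := meets false.
have uv : u != v by apply: contra_eq_neq vb => <-; rewrite ub.
have euv : edge u v = ~~ p by rewrite edgeE uv ub vb; case: (p : bool).
case/orP: (orbN p) => pE.
  rewrite ifT // in uP; rewrite ifT // in vP.
  by have := clK _ _ uP vP uv; rewrite euv => /negP[].
rewrite ifN // in uP; rewrite ifN // in vP.
by have := stS _ _ uP vP; rewrite euv => /negP[].
Qed.

(** The sides of the two embeddings are the two colourings, and exactly one of
    them separates each pair of distinct vertices; the final case analysis is
    the parity count over the three pairs. *)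
Lemma two_sided_embeddings_small (H : sgraph) (m n : nat) :
  induced_subgraph H (two_sided false m) ->
  induced_subgraph H (two_sided true n) -> #|H| <= 2.
Proof.
move=> /induced_subgraphP [f f_inj fE] /induced_subgraphP [g g_inj gE].
have sep x y : x != y -> ((f x).1 == (f y).1) = ((g x).1 != (g y).1).
  move=> xy; have := fE x y; rewrite -gE /edge /= /two_sided_edge.
  rewrite (inj_eq f_inj) (inj_eq g_inj) xy /=.
  by case: (_.1 == (f y).1); case: (_.1 == (g y).1).
rewrite leqNgt; apply/negP => /card_gt2P [x [y [z [_ [xy yz zx]]]]].
move: (sep _ _ xy) (sep _ _ yz) (sep _ _ zx).
by case: (f x).1; case: (f y).1; case: (f z).1;
  case: (g x).1; case: (g y).1; case: (g z).1.
Qed.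

Lemma split_no_deletion (G : sgraph) (K S : {set G}) :
  clique K -> stable S -> K :|: S = [set: G] ->
  exists X : {set G}, #|X| <= 0 /\ split_graph (delete_vertices X).
Proof.
move=> clK stS KS; exists set0; rewrite cards0; split=> //.
exists [set u | val u \in K], [set u | val u \in S]; split.
- move=> u v; rewrite !inE => uK vK uv; exact: clK.
- move=> u v; rewrite !inE; exact: stS.
- by apply/setP=> u; rewrite !inE -in_setU KS inE.
Qed.

Theorem theorem8p1 (H : sgraph) :
  bounded_apex_split (fun G : sgraph => free H G) <->
  (induced_subgraph H (complete_graph 2) \/
   induced_subgraph H (edgeless_graph 2)).
Proof.
split=> [[c apex]|[HK|HS]].
- apply: card_le2_induced.
  have embeds p : ~ free H (two_sided p c.+2).
    by move=> /apex [X [Xc]]; apply: two_sided_not_apex_split.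
  (* The bound is decidable, so doubly negated embeddings are enough. *)
  apply/negP=> big; apply: (embeds false) => Hf; apply: (embeds true) => Ht.
  exact: big (two_sided_embeddings_small Hf Ht).
- exists 0 => G HG; apply: (@split_no_deletion G set0 setT).
  + by move=> x y; rewrite inE.
  + move=> x y _ _; apply/negP => xy; apply: HG.
    exact: induced_subgraph_trans HK (induced_complete2 xy).
  + by rewrite set0U.
- exists 0 => G HG; apply: (@split_no_deletion G setT set0).
  + move=> x y _ _ xy; apply/negPn/negP => nxy; apply: HG.
    exact: induced_subgraph_trans HS (induced_edgeless2 xy nxy).
  + by move=> x y; rewrite inE.
  + by rewrite setU0.
Qed.
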